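(* Let $\Phi$ be a Hausdorff topological space endowed with a bornology $\mathbb B$, and let $S(t):\Phi\to\Phi$, $t\ge 0$, be a semigroup. Assume that $S(t)$ possesses a compact $\mathbb B$-attracting set $\mathcal B\subset\Phi$. Then there exists a $\mathbb B$-attractor $\mathcal A$ of $S(t)$, which can be obtained as $$\mathcal A=\Big[\bigcup_{B\in\mathbb B}\omega(B)\Big]_\Phi .$$
   Context: A semigroup on $\Phi$ is a family of maps $S(t):\Phi\to\Phi$, $t\ge0$, with $S(0)=\mathrm{Id}$ and $S(t+h)=S(t)\circ S(h)$ for $t,h\ge 0$; no continuity of $S(t)$ is assumed. A bornology $\mathbb B$ on $\Phi$ is an arbitrary family of non-empty subsets of $\Phi$ (no further axioms are required). $[V]_\Phi$ denotes the closure of $V$ in $\Phi$. A set $\mathcal B\subset\Phi$ is $\mathbb B$-attracting if for every $B\in\mathbb B$ and every neighbourhood $\mathcal O(\mathcal B)$ of $\mathcal B$ there is $T=T(B,\mathcal O)$ such that $S(t)B\subset\mathcal O(\mathcal B)$ for all $t\ge T$. The $\omega$-limit set of $B\subset\Phi$ is $\omega(B):=\bigcap_{T\ge0}\big[\bigcup_{t\ge T}S(t)B\big]_\Phi$. A set $\mathcal A\subset\Phi$ is a $\mathbb B$-attractor of $S(t)$ if: 1) $\mathcal A$ is compact in $\Phi$; 2) $\mathcal A$ is $\mathbb B$-attracting; 3) $\mathcal A$ is a minimal (by inclusion) set satisfying 1) and 2). *)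

(* Defs.v *)
From mathcomp Require Import all_boot all_order all_algebra.
From mathcomp Require Import all_classical all_reals topology.

Set Implicit Arguments.
Unset Strict Implicit.
Unset Printing Implicit Defensive.

Import Order.TTheory GRing.Theory Num.Theory.
Local Open Scope classical_set_scope.
Local Open Scope ring_scope.

(* A family of maps indexed by t >= 0 is encoded as a function on all of R;
   every notion below only involves its values at nonnegative times. *)
Definition is_semigroup (R : realType) (Phi : Type) (S : R -> Phi -> Phi) :=
  S 0 =1 id /\
  forall t h : R, 0 <= t -> 0 <= h -> S (t + h) =1 S t \o S h.

Definition is_bornology (Phi : Type) (BB : set (set Phi)) :=
  forall B, BB B -> B !=set0.

(* By set_nbhsP, set_nbhs A O holds iff O contains an open set containing A. *)
Definition attracting (R : realType) (Phi : topologicalType)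
    (BB : set (set Phi)) (S : R -> Phi -> Phi) (A : set Phi) :=
  forall B, BB B -> forall O, set_nbhs A O ->
    exists T : R, 0 <= T /\ forall t, T <= t -> S t @` B `<=` O.

Definition omega_limit (R : realType) (Phi : topologicalType)
    (S : R -> Phi -> Phi) (B : set Phi) : set Phi :=
  \bigcap_(T in [set T : R | 0 <= T])
    closure (\bigcup_(t in [set t : R | T <= t]) S t @` B).

Definition attractor (R : realType) (Phi : topologicalType)
    (BB : set (set Phi)) (S : R -> Phi -> Phi) (A : set Phi) :=
  [/\ compact A,
      attracting BB S A &
      forall C, compact C -> attracting BB S C -> C `<=` A -> C = A].

(* Main.v *)
Require Import Defs.
From mathcomp Require Import all_boot all_order all_algebra.
From mathcomp Require Import all_classical all_reals topology num_normedtype.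
Local Open Scope classical_set_scope.
Local Open Scope ring_scope.
Import Order.TTheory Num.Theory.

(** Separating points from compact sets shows that every omega-limit set lies in
    every compact attracting set, which yields compactness and minimality of the
    closure [A] of their union. For attraction, let [O] be a neighbourhood of [A]
    and [K] a compact attracting set: each point of [K] either lies in
    [omega(B)], hence in the interior of [O], or has a neighbourhood missed by
    the tail [{S(t)b | t >= T}] of the orbits of [B] for some [T]. By
    compactness one [T] serves for all of [K], so the union of [O] and the
    complement of that tail is a neighbourhood of [K]; it absorbs [S(t)B], which
    must therefore enter [O]. *)

Lemma hausdorff_compact_separated (X : topologicalType) (K : set X) (x : X) :
  hausdorff_space X -> compact K -> ~ K x ->
  exists2 V, nbhs x V & set_nbhs K (~` V).
Proof.
rewrite open_hausdorff => hX /compact_near_coveringP cK nKx.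
(* Along the filter of small neighbourhoods [V] of [x], compactness yields one [V] that serves every
   [y] in [K]. *)
have [] := cK _ (powerset_filter_from (nbhs x)) (fun V y => nbhs y (~` V)).
  move=> y Ky; have /hX : y != x by apply: contra_notN nKx => /eqP <-.
  case=> -[U W] /= [/set_mem Uy /set_mem Wx] [oU oW /eqP UW0].
  exists (U, [set V | V `<=` W]) => /=.
    by split; [exact: open_nbhs_nbhs | exact/small_set_sub/open_nbhs_nbhs].
  move=> [z V] /= [Uz VW]; apply: filterS (open_nbhs_nbhs (conj oU Uz)).
  move=> u Uu Vu; have : (U `&` W) u by split=> //; exact: VW.
  by rewrite UW0.
move=> M [MF _ [V MV]] MK; exists V; first exact: MF.
by move=> y /(MK V MV).
Qed.

Section CompactAttracting.
Context {R : realType} {Phi : topologicalType} {BB : set (set Phi)}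
  {S : R -> Phi -> Phi} {K : set Phi}.
Hypotheses (cK : compact K) (attK : attracting BB S K).

Lemma omega_limit_sub_attracting (B : set Phi) :
  hausdorff_space Phi -> BB B -> omega_limit S B `<=` K.
Proof.
move=> hPhi BBB x wx; apply: contrapT => nKx.
have [V Vx KV] := hausdorff_compact_separated _ _ _ hPhi cK nKx.
have [T [T0 TV]] := attK _ BBB _ KV.
have [y [[t /= Tt SBy] Vy]] := wx T T0 _ Vx.
exact: TV Tt _ SBy Vy.
Qed.

Lemma attracting_omega_limit (A : set Phi) :
  (forall B, BB B -> omega_limit S B `<=` A) -> attracting BB S A.
Proof.
move=> wA B BBB O AO.
pose tail T := \bigcup_(t in [set t : R | T <= t]) S t @` B.
have [] := iffLR (compact_near_coveringP K) cK _ (pinfty_nbhs R)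
  (fun T x => nbhs x (~` tail T `|` O)).
  move=> x _; have [wx|] := pselect (omega_limit S B x).
    have /nbhs_interior Ox : nbhs x O by apply: AO; exact: wA wx.
    exists (O^°, setT) => /=; first by split=> //; exact: filterT.
    by move=> [y T] /= [Oy _]; apply: filterS Oy; right.
  move=> /existsNP[T /not_implyP[_]] /existsNP[U] /not_implyP[Ux nTU].
  exists (U^°, [set T' | T <= T']) => /=.
    by split; [exact: nbhs_interior | exact: nbhs_pinfty_ge (num_real T)].
  move=> [y T'] /= [Uy TT']; apply: filterS Uy => z Uz.
  left=> -[t /= T't SBz]; apply: nTU; exists z; split=> //.
  by exists t => //=; exact: le_trans TT' T't.
(* The bound at infinity is strict, hence [T + 1]. *)
move=> T [_ /(_ (T + 1))]; rewrite ltrDl ltr01 => /(_ isT) KO.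
have [T' [T'0 T'O]] := attK _ BBB _ KO.
(* Past [T + 1] the orbits lie in [tail (T + 1)], which leaves only [O]. *)
exists (Num.max T' (T + 1)); split; first by rewrite le_max T'0.
move=> t; rewrite ge_max => /andP[T't Tt] y Sy.
by case: (T'O t T't y Sy) => // -[]; exists t.
Qed.

End CompactAttracting.

Theorem theorem3p3 (R : realType) (Phi : topologicalType)
    (BB : set (set Phi)) (S : R -> Phi -> Phi) :
  hausdorff_space Phi ->
  is_bornology BB ->
  is_semigroup S ->
  (exists K : set Phi, compact K /\ attracting BB S K) ->
  exists A : set Phi,
    attractor BB S A /\ A = closure (\bigcup_(B in BB) omega_limit S B).
Proof.
move=> hPhi _ _ [K [cK attK]].
have closure_sub C : compact C -> attracting BB S C ->
    closure (\bigcup_(B in BB) omega_limit S B) `<=` C.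
  move=> cC attC; rewrite [X in _ `<=` X](closure_id C).1; last first.
    exact: compact_closed hPhi cC.
  apply: closure_subset => x [B BBB wx].
  exact: (omega_limit_sub_attracting cC attC) wx.
exists (closure (\bigcup_(B in BB) omega_limit S B)); split=> //; split.
- exact: subclosed_compact (@closed_closure _ _) cK (closure_sub _ cK attK).
- apply: (attracting_omega_limit cK attK) => B BBB x wx.
  by apply: subset_closure; exists B.
- by move=> C cC attC CA; apply/seteqP; split=> //; exact: closure_sub.
Qed.
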